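(* Let $G=(V,E,\phi)$ be an undirected graph with non-negative vertex weights $\phi:V\to\mathbb{R}_{\ge0}$, and let $M_A$ be the matching output by the Two-Thirds approximation algorithm described in the context. Then $M_A$ is a $2/3$-approximation for the maximum vertex-weighted matching problem: for every matching $M$ of $G$, $\phi(M)\le \tfrac{3}{2}\,\phi(M_A)$, where the weight $\phi(M)$ of a matching is the sum of the weights of the vertices it matches.
   Context: A matching $M$ is a set of edges no two of which share an endpoint; a vertex is matched if it is an endpoint of an edge of $M$, otherwise unmatched. The maximum vertex-weighted matching problem asks for a matching maximizing the sum of the weights of its matched vertices. An $M$-augmenting path is a path whose edges alternate between edges not in $M$ and edges in $M$ and whose two endpoints are unmatched; augmenting means replacing $M$ by $M\oplus P$. The Two-Thirds approximation algorithm: sort the vertices in non-increasing order of weight (ties broken consistently) into a queue $Q$, and set $M=\emptyset$. While $Q\neq\emptyset$: remove the first (heaviest) vertex $u$ from $Q$; among all unmatched vertices $v$ reachable from $u$ by an $M$-augmenting path $P$ of length (number of edges) at most three, choose a heaviest one; if such a path exists, set $M\gets M\oplus P$ and remove $v$ from $Q$. Output the final $M$. *)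

(* Defs.v *)
From mathcomp Require Import all_boot all_order all_algebra.

Set Implicit Arguments.
Unset Strict Implicit.
Unset Printing Implicit Defensive.

Import Order.TTheory GRing.Theory Num.Theory.
Local Open Scope ring_scope.

(* A finite simple graph is an (intended symmetric, irreflexive) relation e on
   a finite type V; an edge is the unordered pair [set x; y] of its endpoints,
   so that the vertices matched by a matching M are exactly those in cover M. *)

Section VertexWeightedMatching.

Variables (V : finType) (e : rel V).
Implicit Types (M : {set {set V}}) (x u : V) (p q Q : seq V).

Definition edges : {set {set V}} :=
  [set [set a.1; a.2] | a in [set a : V * V | e a.1 a.2]].

Definition is_matching M : bool := (M \subset edges) && trivIset M.

Definition edge_seq x p : seq {set V} := pairmap (fun a b => [set a; b]) x p.

(* The path x :: p has size p edges. The condition p != [::] excludes the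
   one-vertex path, so the two endpoints x and last x p are distinct. *)
Definition augmenting M x p : bool :=
  [&& p != [::], path e x p, uniq (x :: p),
      sorted (fun A B : {set V} => (A \in M) != (B \in M)) (edge_seq x p),
      x \notin cover M & last x p \notin cover M].

Definition short_augmenting M x p : bool :=
  augmenting M x p && (size p <= 3)%N.

Definition augment M x p : {set {set V}} :=
  let P := [set:: edge_seq x p] in (M :\: P) :|: (P :\: M).

Variables (R : realFieldType) (phi : V -> R).

Definition matching_weight M : R := \sum_(v in cover M) phi v.

(* two_thirds_run Q M M': started in the state (Q, M), the loop can terminate
   with the matching M'. Which of the heaviest reachable vertices is chosen,
   and along which path, is left nondeterministic. *)
Inductive two_thirds_run :
    seq V -> {set {set V}} -> {set {set V}} -> Prop :=
| Run_done M : two_thirds_run [::] M M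
| Run_augment u Q M p M' :
    short_augmenting M u p ->
    (forall q, short_augmenting M u q -> phi (last u q) <= phi (last u p)) ->
    two_thirds_run (rem (last u p) Q) (augment M u p) M' ->
    two_thirds_run (u :: Q) M M'
| Run_skip u Q M M' :
    (forall p, ~~ short_augmenting M u p) ->
    two_thirds_run Q M M' ->
    two_thirds_run (u :: Q) M M'.

(* The order of Q among vertices of equal weight is arbitrary, so every way of
   breaking ties is covered. *)
Definition two_thirds_output M : Prop :=
  exists Q : seq V,
    [/\ perm_eq Q (enum V),
        sorted (fun a b => phi b <= phi a) Q &
        two_thirds_run Q set0 M].

End VertexWeightedMatching.

(* Main.v *)
(* Replacing the weights by the indicators of the sets [H = {v | t <= phi v}]
   turns a run into a run up to the last heavy queue head, so it suffices to show
   that every matching covers at most 3/2 times as many vertices of [H] as the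
   output (layer-cake). A step that matches a heavy origin [x] with a light
   terminus [y] makes [x] dead: as [y] was a heaviest choice, [x] reaches no
   unmatched heavy vertex. Since each dead vertex is paired with a light one, the
   matched vertices that are not dead are as many as the matched heavy ones.
   Following the optimal matching and the output alternately from a heavy vertex
   that failed, the first and the third vertex are matched and reach that vertex,
   hence are not dead (up to an odd-cycle exception, where the second one replaces
   the third). So each failure is charged to two matched
   vertices that are not dead; when the path ends too early, the second vertex may
   be dead, but then it is a heavy vertex matched by the output only. *)

Require Import Defs.
From mathcomp Require Import all_boot all_order all_algebra.
From mathcomp Require Import zify.
Import Order.TTheory GRing.Theory Num.Theory.
Local Open Scope ring_scope.

Set Implicit Arguments.
Unset Strict Implicit.
Unset Printing Implicit Defensive.

(** * Unordered pairs and case analysis on vertex equalities *)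

Lemma eq_set2 (T : finType) (a b c d : T) :
  ([set a; b] == [set c; d]) = (a == c) && (b == d) || (a == d) && (b == c).
Proof.
apply/eqP/idP => [E|/orP[]/andP[/eqP-> /eqP->]//]; last by rewrite setUC.
have: a \in [set c; d] by rewrite -E set21.
have: b \in [set c; d] by rewrite -E set22.
have: c \in [set a; b] by rewrite E set21.
have: d \in [set a; b] by rewrite E set22.
rewrite !inE ![_ == a]eq_sym ![_ == b]eq_sym.
by do 4!case: eqVneq => ? //=.
Qed.

Ltac eq_cases := rewrite /=;
  repeat (match goal with |- context [?a == ?b] =>
    lazymatch a with
    | context [if _ then _ else _] => fail
    | _ => case: (eqVneq a b) => [?|/eqP ?] //=
    end end; try congruence);
  try (move=> *; congruence).

(** * Matchings as involutions *)

Section Matings.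

Variables (V : finType) (e : rel V).
Hypotheses (e_sym : symmetric e) (e_irr : irreflexive e).
Implicit Types (f g : V -> V) (u v w x y z : V) (H D : {set V}) (Q : seq V).

(* Matchings are handled as involutions, whose fixed points are the unmatched
   vertices. *)
Definition mating f := involutive f /\ forall v, f v != v -> e v (f v).
Definition matched f := [set v | f v != v].
Definition mating_edges f : {set {set V}} :=
  [set [set v; f v] | v in matched f].

Lemma in_mating_edges f v w : mating f ->
  ([set v; w] \in mating_edges f) = (v != w) && (f v == w).
Proof.
move=> [fK _]; apply/imsetP/andP => [[z]|[vw /eqP fv]]; last first.
  by exists v; rewrite ?inE fv // eq_sym.
rewrite inE => fz /eqP; rewrite eq_set2.
by case/orP => /andP[/eqP-> /eqP->]; split; rewrite ?fK // eq_sym.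
Qed.

Lemma cover_mating_edges f : mating f -> cover (mating_edges f) = matched f.
Proof.
move=> [fK _]; apply/setP => v; apply/bigcupP/idP => [[_ /imsetP[z fz ->]]|fv].
  by move: fz; rewrite !inE => fz /orP[]/eqP-> //; rewrite fK eq_sym.
by exists [set v; f v]; [apply: imset_f | rewrite set21].
Qed.

(** Disjointness makes partners unique, so picking one, with the vertex itself as default, gives an
    involution; irreflexivity ensures that no edge hides at a fixed point. *)
Lemma matching_mating M : is_matching e M ->
  exists2 f, mating f & M = mating_edges f.
Proof.
move=> /andP[/subsetP Me /trivIsetP tM].
have edgeM v w : [set v; w] \in M -> e v w.
  move=> /Me/imsetP[[a b]]; rewrite inE /= => eab /eqP.
  by rewrite eq_set2 => /orP[]/andP[/eqP-> /eqP->]; rewrite // e_sym.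
have uniqM v w w' : [set v; w] \in M -> [set v; w'] \in M -> w = w'.
  move=> vw vw'; have [/eqP|/(tM _ _ vw vw')] := eqVneq [set v; w] [set v; w'].
    by rewrite eq_set2 eqxx => /orP[/eqP//|/andP[/eqP-> /eqP->]].
  by rewrite -setI_eq0 => /eqP/setP/(_ v); rewrite !inE eqxx.
pose f v := odflt v [pick w | [set v; w] \in M].
have fE v w : [set v; w] \in M -> f v = w.
  rewrite /f; case: pickP => [w' vw' vw|/(_ w) ->//].
  exact: uniqM vw' vw.
have fM v : f v != v -> [set v; f v] \in M.
  by rewrite /f; case: pickP => //= _; rewrite eqxx.
have fmat : mating f.
  split=> v; last by move=> /fM/edgeM.
  have [fv|/fM vM] := eqVneq (f v) v; first by rewrite !fv.
  by apply: fE; rewrite setUC.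
exists f => //; apply/setP => A; apply/idP/imsetP => [AM|[v]].
  have /Me/imsetP[[a b] _ /= EA] := AM.
  exists a; last by rewrite (fE a b) // -EA.
  rewrite inE (fE a b) -?EA //; apply: contraTneq AM => ba.
  by rewrite EA ba; apply/negP => /edgeM; rewrite e_irr.
by rewrite inE => /fM ? ->.
Qed.

(* With [w] unmatched, [link f u w] says that [w] is reached from [u] by an
   augmenting path of length at most three, except that it allows [u = w]. *)
Definition near f z w := (z == w) || (f z != z) && e (f z) w.
Definition link f u w := exists2 z, e u z & near f z w.

(** Lengths one and three suffice: with two edges, alternation would match one of the unmatched
    endpoints. *)
Inductive step f x y : (V -> V) -> Prop :=
| Step1 of e x y :
    step f x y (fun v => if v == x then y else if v == y then x else f v)
| Step3 a of e x a & f a != a & e (f a) y :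
    step f x y (fun v => if v == x then a else if v == a then x else
                         if v == f a then y else if v == y then f a else f v).

Lemma link_sym f u w : mating f -> link f u w -> link f w u.
Proof.
move=> [fK _] [z uz /orP[/eqP<-|/andP[fz zw]]].
  by exists u; rewrite 1?e_sym // /near eqxx.
by exists (f z); rewrite 1?e_sym // /near fK [z == _]eq_sym fz e_sym uz orbT.
Qed.

(** * Short augmenting paths as steps between involutions *)

Lemma eq_pairs (A B : {set {set V}}) :
    (forall X, X \in A -> exists a b, a != b /\ X = [set a; b]) ->
    (forall X, X \in B -> exists a b, a != b /\ X = [set a; b]) ->
    (forall a b, a != b -> ([set a; b] \in A) = ([set a; b] \in B)) ->
  A = B.
Proof.
move=> pA pB AB; apply/setP => X; apply/idP/idP => XA.
  by have [a [b [ab EX]]] := pA _ XA; rewrite EX -AB // -EX.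
by have [a [b [ab EX]]] := pB _ XA; rewrite EX AB // -EX.
Qed.

Lemma mating_edges_pair f X : X \in mating_edges f ->
  exists a b, a != b /\ X = [set a; b].
Proof.
by case/imsetP => v; rewrite inE eq_sym => fv ->; exists v, (f v).
Qed.

Lemma step_mating f x y f' : mating f -> f x = x -> f y = y -> x != y ->
  step f x y f' -> mating f'.
Proof.
move=> [fK fe] fx fy /eqP xy [exy|a exa /eqP fa fay].
  split=> v; first by have := fK v; eq_cases.
  have [->|vx] := eqVneq v x; first by [].
  by have [->|vy] := eqVneq v y; [rewrite e_sym | apply: fe].
split=> v; first by have := fK v; have := fK a; eq_cases.
have [->|vx] := eqVneq v x; first by [].
have [->|va] := eqVneq v a; first by rewrite e_sym.
have [->|vb] := eqVneq v (f a); first by [].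
by have [->|vy] := eqVneq v y; [rewrite e_sym | apply: fe].
Qed.

Lemma step_matched f x y f' : mating f -> f x = x -> f y = y -> x != y ->
  step f x y f' -> matched f' = x |: (y |: matched f).
Proof.
move=> [fK fe] fx fy /eqP xy.
case=> [exy|a exa /eqP fa fay]; apply/setP => v; rewrite !inE.
  by have := fK v; eq_cases.
by have := fK v; have := fK a; eq_cases.
Qed.

Lemma short_augmentingP f x p :
    mating f -> short_augmenting e (mating_edges f) x p ->
  [/\ f x = x, f (last x p) = last x p, x != last x p &
      exists2 f', step f x (last x p) f' &
                  augment (mating_edges f) x p = mating_edges f'].
Proof.
move=> fmat; have [fK fe] := fmat.
have fE c d : (f c == d) = (c == f d) by rewrite (inv_eq fK).
rewrite /short_augmenting /augmenting cover_mating_edges // !inE !negbK.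
case/andP => /and5P[p0 ep up altp /andP[/eqP fx /eqP fy]] szp.
have xp : x != last x p.
  case: p p0 up {ep altp fy szp} => //= a p _ /andP[xp _].
  by apply: contraNneq xp => ->; rewrite mem_last.
split=> //.
have pairs (P : {set {set V}}) f' :
    P \subset [set [set q.1; q.2] | q in [set q : V * V | q.1 != q.2]] ->
    mating f' ->
    (forall c d, c != d ->
      ([set c; d] \in (mating_edges f :\: P) :|: (P :\: mating_edges f)) =
      (f' c == d)) ->
  (mating_edges f :\: P) :|: (P :\: mating_edges f) = mating_edges f'.
  move=> /subsetP Pp f'mat PE; apply: eq_pairs => [X|X|c d cd].
  - rewrite !inE => /orP[/andP[_]|/andP[_ /Pp]]; first exact: mating_edges_pair.
    by case/imsetP => -[a b]; rewrite inE; exists a, b.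
  - exact: mating_edges_pair.
  - by rewrite PE // in_mating_edges ?cd.
case: p p0 ep up altp fy szp xp => // a [|b [|c [|? ?]]] //=
  _ ep up altp fy _ xp.
- rewrite andbT in ep; eexists; first exact: Step1.
  apply: pairs; first 2 last.
  + move=> c d cd; rewrite !inE !in_mating_edges // !eq_set2.
    have := fK c; have := fK d; move/eqP: cd; move/eqP: xp.
    by eq_cases.
  + apply/subsetP => X; rewrite !inE => /eqP->.
    by apply/imsetP; exists (x, a); rewrite ?inE.
  + exact: step_mating (Step1 f ep).
- move: altp up; rewrite !in_mating_edges // !inE !negb_eqb.
  by have := fK a; eq_cases.
- move: altp up ep; rewrite !in_mating_edges // !inE !negb_eqb => altp up.
  have [fab ab] : f a = b /\ a <> b.
    by move: altp up; have := fK a; eq_cases.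
  have [ax xb ac bc] : [/\ a <> x, x <> b, a <> c & b <> c].
    by split; move: up; eq_cases.
  rewrite andbT -fab => /and3P[exa _ ebc].
  have fa : f a != a by rewrite fab eq_sym; apply/eqP.
  eexists; first exact: (Step3 exa fa ebc).
  apply: pairs; first 2 last.
  + move=> u v uv; rewrite !inE !in_mating_edges // !eq_set2.
    have := fK u; have := fK v; have := fK a; move/eqP: uv; move/eqP: xp.
    by eq_cases.
  + apply/subsetP => X; rewrite !inE => /or3P[] /eqP->; apply/imsetP.
    * by exists (x, a); rewrite ?inE //= eq_sym; apply/eqP.
    * by exists (a, f a); rewrite ?inE //= eq_sym.
    * by exists (f a, c); rewrite ?inE //= fab; apply/eqP.
  + exact: step_mating (Step3 exa fa ebc).
Qed.

Lemma link_short_augmenting f x w :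
    mating f -> f x = x -> f w = w -> x != w -> link f x w ->
  exists2 p, short_augmenting e (mating_edges f) x p & last x p = w.
Proof.
move=> fmat fx fw xw [z xz /orP[/eqP zw|/andP[fz zw]]]; have [fK fe] := fmat.
  exists [:: z] => //; subst z.
  rewrite /short_augmenting /augmenting /= cover_mating_edges // !inE.
  by rewrite xz xw fx fw !eqxx.
exists [:: z; f z; w] => //.
rewrite /short_augmenting /augmenting /= cover_mating_edges //.
rewrite !in_mating_edges // !inE.
rewrite xz zw fe // !negb_eqb.
by move: fz xw; have := fK z; eq_cases.
Qed.

(* An edge of the new matching that the old one lacks is entered from one end
   of the augmenting path and left towards a vertex linked to the other end. *)
Lemma step_near f x y f' z w : mating f -> f x = x -> f y = y -> x != y ->
    step f x y f' -> near f' z w ->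
  [\/ near f z w,
      (z = x \/ [/\ f z != z, f z = f' x & e (f z) x]) /\ link f y w |
      near f z y /\ link f x w].
Proof.
move=> [fK fe] fx fy xy; rewrite {1}/near; case=> [exy|a exa fa fay].
  case/orP => [/eqP->|]; first by constructor 1; rewrite /near eqxx.
  have [->|zx] := eqVneq z x.
    case/andP => _ yw; constructor 2; split; first by left.
    by exists w; rewrite ?/near ?eqxx.
  have [->|zy] := eqVneq z y.
    case/andP => _ xw; constructor 3; split; first by rewrite /near eqxx.
    by exists w; rewrite ?/near ?eqxx.
  by move=> zw; constructor 1; rewrite /near zw orbT.
case/orP => [/eqP->|]; first by constructor 1; rewrite /near eqxx.
have bfb : f (f a) != f a by rewrite fK eq_sym.
have [->|zx] := eqVneq z x.
  case/andP => _ aw; constructor 2; split; first by left.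
  by exists (f a); rewrite 1?e_sym // /near bfb fK aw orbT.
have [->|za] := eqVneq z a.
  case/andP => _ xw; constructor 3; split; first by rewrite /near fa fay orbT.
  by exists w; rewrite ?/near ?eqxx.
(* Here [f z] is [a], the new mate of [x]: the exceptional alternative. *)
have [->|zb] := eqVneq z (f a).
  case/andP => _ yw; constructor 2; split; last first.
    by exists w; rewrite ?/near ?eqxx.
  by right; rewrite bfb fK eqxx e_sym.
have [->|zy] := eqVneq z y.
  case/andP => _ bw; constructor 3; split; first by rewrite /near eqxx.
  by exists a; rewrite // /near fa bw orbT.
by move=> zw; constructor 1; rewrite /near zw orbT.
Qed.

(** Among matched vertices only [a] and [f a] change mates, and [a] is adjacent to [x]. *)
Lemma step_mate f x y f' d : mating f -> f x = x -> f y = y ->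
    step f x y f' -> f d != d ->
  [\/ f' d = f d, e d x | e (f d) x].
Proof.
move=> [fK fe] fx fy [exy|a exa fa fay] fd.
  have [dx|_] := eqVneq d x; first by rewrite dx fx eqxx in fd.
  have [dy|_] := eqVneq d y; first by rewrite dy fy eqxx in fd.
  by constructor 1.
have [dx|_] := eqVneq d x; first by rewrite dx fx eqxx in fd.
have [->|_] := eqVneq d a; first by constructor 2; rewrite e_sym.
have [->|_] := eqVneq d (f a); first by constructor 3; rewrite fK e_sym.
have [dy|_] := eqVneq d y; first by rewrite dy fy eqxx in fd.
by constructor 1.
Qed.

(* [D] collects the origins of the steps whose terminus is not heavy; call them
   dead. Like a failed vertex, a dead [d] is not linked to an unmatched heavy [w],
   except that a step [x, a, f a, y] in which [x] is also adjacent to [f a] leaves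
   [x] linked through [f a] to the neighbours of [y]. This is why [inv_near] only
   constrains such a link instead of excluding it. *)
Record invariant H Q f D : Prop := Invariant {
  inv_mating : mating f;
  inv_uniq : uniq Q;
  inv_queue : forall u, u \in Q -> f u = u;
  inv_failed : forall u w, f u = u -> f w = w -> u != w -> u \notin Q ->
    ~ link f u w;
  inv_dead : D \subset matched f :&: H;
  inv_near : forall d z w, d \in D -> w \in H -> f w = w -> e d z ->
    near f z w ->
    [/\ z != w, z \notin D &
        forall w', w' \in H -> f w' = w' -> ~~ e (f d) w'];
  inv_card : (#|matched f| <= #|matched f :&: H| + #|D|)%N }.

(** * Preservation of the invariant and the resulting bound *)

Lemma invariant_skip H x Q f D : invariant H (x :: Q) f D ->
  (forall w, f w = w -> x != w -> ~ link f x w) -> invariant H Q f D.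
Proof.
case=> fmat /= /andP[xQ uQ] fQ failed DH nearD cardD xfail; split=> //.
  by move=> u uQ'; apply: fQ; rewrite inE uQ' orbT.
move=> u w fu fw uw uQ'; have [ux|ux] := eqVneq u x.
  by rewrite ux; apply: xfail; rewrite -?ux.
by apply: failed => //; rewrite inE negb_or ux.
Qed.

(** The last hypothesis records the greedy choice: a heavy unmatched vertex linked to [x] forces [y]
    to be heavy. *)
Lemma invariant_step H x y Q f D f' :
    invariant H (x :: Q) f D -> x \in H -> f y = y -> x != y ->
    step f x y f' ->
    (forall w, w \in H -> f w = w -> x != w -> link f x w -> y \in H) ->
  exists D', invariant H (rem y Q) f' D'.
Proof.
case=> fmat /= /andP[xQ uQ] fQ failed DH nearD cardD xH fy xy fs ymax.
have fx : f x = x by apply: fQ; rewrite mem_head.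
have fE := step_matched fmat fx fy xy fs.
have unm w : f' w = w -> [/\ f w = w, x != w & y != w].
  move=> fw; have: w \notin matched f' by rewrite inE fw eqxx.
  by rewrite fE !inE !negb_or negbK ![w == _]eq_sym => /and3P[-> -> /eqP->].
have Dm d : d \in D -> [/\ f d != d, d \in H & d != x].
  move=> /(subsetP DH); rewrite !inE => /andP[fd dH]; split=> //.
  by apply: contraNneq fd => ->; rewrite fx.
have nearxw w z : near f z w -> w \in H -> f' w = w -> e x z -> y \in H.
  by move=> zw wH /unm[fw xw _] xz; apply: (ymax w) => //; exists z.
exists (if y \in H then D else x |: D); split.
- exact: step_mating fs.
- exact: rem_uniq.
- move=> u; rewrite (mem_rem_uniq _ uQ) !inE => /andP[uy uQ'].
  have fu : f u = u by apply: fQ; rewrite inE uQ' orbT.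
  apply/eqP; have: u \notin matched f'.
    rewrite fE !inE fu eqxx orbF negb_or uy andbT.
    by apply: contraNneq xQ => <-.
  by rewrite inE negbK.
- move=> u w /unm[fu xu yu] /unm[fw xw yw] uw uQ'.
  have {uQ'}uQ' : u \notin x :: Q.
    move: uQ'; rewrite (mem_rem_uniq _ uQ) !inE negb_or ![u == _]eq_sym.
    by rewrite xu yu.
  (* Each case yields an old link from the failed [u], to [w], [x] or [y]. *)
  case=> z uz /(step_near fmat fx fy xy fs)[zw|[zx _]|[zy _]].
  + by apply: (failed u w) => //; exists z.
  + apply: (failed u x) => //; first by rewrite eq_sym.
    exists z => //; rewrite /near; case: zx => [->|[-> _ ->]].
      by rewrite eqxx.
    by rewrite orbT.
  + by apply: (failed u y) => //; [rewrite eq_sym | exists z].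
- apply/subsetP => d; rewrite fE; case: ifP => _; rewrite !inE.
    by move=> /Dm[-> -> _]; rewrite !orbT.
  by case/orP => [/eqP->|/Dm[-> -> _]]; rewrite ?eqxx ?xH ?orbT.
(* An older dead [d] had an old link through [z] to [w], [x] or a heavy [y], so its old constraint
   applies. *)
- have old d z w : d \in D -> w \in H -> f' w = w -> e d z -> near f' z w ->
      [/\ z != w, z \notin x |: D &
          forall w', w' \in H -> f' w' = w' -> ~~ e (f' d) w'].
    move=> dD wH fw dz zw; have [fw0 xw yw] := unm _ fw.
    have [fd dH dx] := Dm _ dD.
    have zw' : z != w.
      apply/eqP => zw0; have [] := nearD d z w dD wH fw0 dz.
        by rewrite /near zw0 eqxx.
      by rewrite zw0 eqxx.
    have dNx : ~~ e d x.
      apply/negP => ed; have [] := nearD d x x dD xH fx ed;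
        by rewrite ?/near ?eqxx.
    have zx : z != x by apply: contraNneq dNx => <-.
    have [zD fdw] : z \notin D /\
        forall w', w' \in H -> f w' = w' -> ~~ e (f d) w'.
      case: (step_near fmat fx fy xy fs zw) => [zw1|[zx1 _]|[zy xw1]].
      + by have [] := nearD d z w dD wH fw0 dz zw1.
      + have [] := nearD d z x dD xH fx dz; last by [].
        by case: zx1 => [->|[fz _ zx1]]; rewrite /near ?eqxx // fz zx1 orbT.
      + have yH : y \in H by apply: (ymax w).
        by have [] := nearD d z y dD yH fy dz zy.
    split=> //; first by rewrite !inE negb_or zx.
    move=> w' wH' /unm[fw' _ _].
    case: (step_mate fmat fx fy fs fd) => [->|dx'|dx']; first exact: fdw.
      by rewrite dx' in dNx.
    by have := fdw x xH fx; rewrite dx'.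
  move=> d z w; case: ifP => yH dD wH fw dz zw.
    have [? zD ?] := old d z w dD wH fw dz zw; split=> //.
    by apply: contraNN zD => zD; rewrite inE zD orbT.
  move: dD; rewrite !inE => /orP[/eqP dx|dD]; last first.
    have [? zD ?] := old d z w dD wH fw dz zw.
    by split=> //; rewrite !inE in zD.
  subst d; have [fw0 xw yw] := unm _ fw.
  have zx : z != x by apply: contraTneq dz => ->; rewrite e_irr.
  case: (step_near fmat fx fy xy fs zw) => [zw1|[[zx1|[fz fzE zx1]] _]|[_ xw1]].
  + by rewrite (nearxw w z) in yH.
  + by rewrite zx1 eqxx in zx.
  (* The odd cycle: [x] is adjacent to [z] and to [f z], its new mate. A heavy unmatched neighbour
     of [f z] would be linked to [x] through [z], against [y] being light. *)
  + split; first by apply: contraNneq fz => ->; rewrite fw0.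
      rewrite negb_or zx /=; apply/negP => zD.
      have [] := nearD z x x zD xH fx; rewrite ?/near ?eqxx //.
      by rewrite e_sym.
    move=> w' wH' fw'; apply/negP => aw'.
    by rewrite (nearxw w' z) // /near ?fz ?fzE ?aw' ?orbT in yH.
  + by rewrite (ymax w) in yH.
(* Two more vertices are matched; a light [y] is offset by the new dead [x]. *)
- have xD : x \notin D by apply/negP => /Dm[_ _]; rewrite eqxx.
  rewrite fE cardsU1 cardsU1 !inE (negPf xy) fx fy !eqxx /=.
  case: ifP => yH.
    have -> : (x |: (y |: matched f)) :&: H = x |: (y |: (matched f :&: H)).
      by apply/setP => v; rewrite !inE; do 2!case: eqVneq => [->|_] //=.
    by rewrite !cardsU1 !inE (negPf xy) fx fy !eqxx /=; move: cardD; clear; lia.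
  have -> : (x |: (y |: matched f)) :&: H = x |: (matched f :&: H).
    apply/setP => v; rewrite !inE; case: eqVneq => [->|_] //=.
    by case: eqVneq => [->|_] //=; rewrite yH andbF.
  by rewrite !cardsU1 !inE fx eqxx (negPf xD) /=; move: cardD; clear; lia.
Qed.

(* A heavy [u] matched by [g] but not by [f] starts an alternating path with
   vertices [u], [v1 = g u], [v2 = f v1], [v3 = g v2]. It is charged to [v1] and
   to [v3], or to [v2] if [v3] is dead; all these charges are distinct. The path
   may end at [v2], in which case [v3 = v2]. *)
Lemma invariant_bound H Q f D g : invariant H Q f D ->
    (forall u, u \in Q -> u \notin H) -> mating g ->
  (2 * #|matched g :&: H| <= 3 * #|matched f :&: H|)%N.
Proof.
case=> -[fK fe] _ _ failed DH nearD cardD QH [gK ge].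
have fmat : mating f by [].
pose S := (matched g :&: H) :\: matched f.
pose v2 u := f (g u); pose v3 u := g (v2 u).
pose h u := if v3 u \in D then v2 u else v3 u.
have SP u : u \in S ->
    [/\ u \in H, f u = u, g u != u, e u (g u) & f (g u) != g u].
  rewrite !inE negbK => /andP[/eqP fu /andP[gu uH]]; split=> //; first exact: ge.
  apply/negP => /eqP fgu; apply: (failed u (g u)) => //.
    by rewrite eq_sym.
    by apply: contraL uH => /QH.
  by exists (g u); [exact: ge | rewrite /near eqxx].
have f2 u : f (v2 u) = g u by rewrite /v2 fK.
have Dm d : d \in D -> f d != d /\ d \in H.
  by move=> /(subsetP DH); rewrite !inE => /andP[].
have near2 u : u \in S -> near f (v2 u) u.
  case/SP => uH fu gu egu fgu; rewrite /near /v2 fK [g u == _]eq_sym.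
  by rewrite fgu e_sym egu orbT.
have gD u : u \in S -> g u \notin D.
  case/SP => uH fu gu egu fgu; apply/negP => guD.
  have [] := nearD (g u) u u guD uH fu; rewrite ?/near ?eqxx //.
  by rewrite e_sym.
(* [v2 u] leads from a dead [v3 u] to the unmatched heavy [u], so [inv_near] applies. *)
have v3E u : u \in S -> v3 u != v2 u -> v3 u \in D ->
    v2 u \notin D /\ forall w, w \in H -> f w = w -> ~~ e (f (v3 u)) w.
  move=> uS v32 v3D; have [uH fu gu egu fgu] := SP u uS.
  have [] := nearD (v3 u) (v2 u) u v3D uH fu _ (near2 u uS); last by [].
  by rewrite e_sym ge.
have v2m u : u \in S -> v2 u \in matched f.
  by case/SP => _ _ _ _ fgu; rewrite inE /v2 fK eq_sym.
have v3m u : u \in S -> v3 u \in matched f.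
  move=> uS; have [uH fu gu egu fgu] := SP u uS; rewrite inE.
  have [->|v32] := eqVneq (v3 u) (v2 u); first by move: (v2m u uS); rewrite inE.
  apply/negP => /eqP fv3; apply: (failed u (v3 u)) => //.
  - apply: contraNneq fgu => v3u.
    by rewrite [f (g u)](_ : _ = v2 u) // -[v2 u]gK -/(v3 u) -v3u.
  - by apply: contraL uH => /QH.
  by exists (g u) => //; rewrite /near fgu /= orbC ge.
have gS_inj : {in S &, injective g} by move=> u w _ _; apply: (inv_inj gK).
have v2_inj u w : v2 u = v2 w -> u = w by move/(inv_inj fK)/(inv_inj gK).
have h_neq u w : u \in S -> w \in S -> v2 u = v3 w -> v3 u \in D ->
    v3 w \notin D -> u = w.
  move=> uS wS uw v3D v3ND.
  have [v32|v32] := eqVneq (v3 u) (v2 u); first by rewrite -uw -v32 v3D in v3ND.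
  have [_ /(_ w)] := v3E u uS v32 v3D; have [wH fw _ egw _] := SP w wS.
  (* The mate of [v2 w] is [g w], which is adjacent to the unmatched heavy [w]; [v3E] forbids this
     for [v3 u]. *)
  have -> : v3 u = v2 w by rewrite /v3 uw /v3 gK.
  by rewrite f2 e_sym egw => /(_ wH fw).
have h_inj : {in S &, injective h}.
  move=> u w uS wS; rewrite /h; case: ifP => uD; case: ifP => wD.
  - exact: v2_inj.
  - by move=> uw; apply: h_neq => //; rewrite wD.
  - by move=> uw; apply/esym; apply: h_neq => //; rewrite uD.
  - by move/(inv_inj gK)/v2_inj.
have gh_disj : [disjoint g @: S & h @: S].
  rewrite -setI_eq0; apply/eqP/setP => v; rewrite !inE.
  apply/negP => /andP[/imsetP[u uS ->] /imsetP[w wS]].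
  have [uH fu gu egu fgu] := SP u uS.
  rewrite /h; case: ifP => wD.
    by move=> guv; have := v3m w wS; rewrite /v3 -guv gK inE fu eqxx.
  by move/(inv_inj gK) => uv; have := v2m w wS; rewrite -uv inE fu eqxx.
have gh_sub : (g @: S) :|: (h @: S) \subset
    (matched f :\: D) :|: ((matched f :&: H) :\: matched g).
  apply/subsetP => v; rewrite inE => /orP[] /imsetP[u uS ->].
    by have [_ _ _ _ fgu] := SP u uS; rewrite !inE gD // fgu.
  have v2mu := v2m u uS; have v3mu := v3m u uS.
  rewrite /h; case: ifP => uD; last by rewrite in_setU in_setD uD v3mu.
  (* If the path ends at [v2 u], this dead vertex is heavy and unmatched by [g]. *)
  have [v32|v32] := eqVneq (v3 u) (v2 u).
    have [_ v2H] : f (v2 u) != v2 u /\ v2 u \in H by apply: Dm; rewrite -v32.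
    rewrite in_setU orbC in_setD in_setI -v32 v3mu v32 v2H inE.
    by rewrite negbK -[g (v2 u)]/(v3 u) v32 eqxx.
  by have [v2D _] := v3E u uS v32 uD; rewrite in_setU in_setD v2D v2mu.
(* With [a] heavy vertices matched by [f] and [b] of them also by [g], the charges give
   [2|S| <= a + (a - b)]; adding [2b] gives [2a + b <= 3a]. *)
have := leq_trans (subset_leq_card gh_sub) (leq_card_setU _ _).1.
have -> : #|(g @: S) :|: (h @: S)| = (#|g @: S| + #|h @: S|)%N.
  by apply/eqP; rewrite (leq_card_setU _ _).2.
rewrite (card_in_imset gS_inj) (card_in_imset h_inj) cardsDS; last first.
  by apply: subset_trans DH (subsetIl _ _).
have := cardsID (matched f) (matched g :&: H).
have := cardsID (matched g) (matched f :&: H).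
have -> : (matched g :&: H) :&: matched f = (matched f :&: H) :&: matched g.
  by rewrite setIAC [matched g :&: _]setIC setIAC.
by rewrite -/S; lia.
Qed.

(** * Runs of the algorithm at a fixed threshold *)

Section Run.

Variables (R : realFieldType) (phi : V -> R).

Definition heavy (t : R) : {set V} := [set v | t <= phi v].

(** Augmenting unmatches no vertex, so a bound at an intermediate state survives to the output. *)
Lemma run_cover Q M MA : two_thirds_run e phi Q M MA ->
  forall f, mating f -> M = mating_edges f -> cover M \subset cover MA.
Proof.
elim=> {Q M MA} [M f _ _ //|u Q M p MA up _ _ IH f fmat EM|
                 u Q M MA _ _ IH f fmat EM].
  move: up IH; rewrite EM => /(short_augmentingP fmat)[fu fp uneq].
  case=> f' fs -> IH.
  have fmat' := step_mating fmat fu fp uneq fs.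
  apply: subset_trans (IH f' fmat' erefl).
  rewrite !cover_mating_edges // (step_matched fmat fu fp uneq fs).
  by rewrite setUA subsetUr.
exact: IH fmat EM.
Qed.

(** At an empty queue or an augmenting light head, sortedness leaves no heavy vertex queued and
    [invariant_bound] applies; other iterations carry the invariant on. *)
Lemma run_bound (t : R) g Q M MA : mating g -> two_thirds_run e phi Q M MA ->
  forall f D, M = mating_edges f ->
    pairwise (fun a b => phi b <= phi a) Q ->
    invariant (heavy t) Q f D ->
  (2 * #|matched g :&: heavy t| <=
   3 * #|cover MA :&: heavy t|)%N.
Proof.
set H := heavy t => gmat.
have stop Q' M' MA' f D :
    two_thirds_run e phi Q' M' MA' -> M' = mating_edges f ->
    invariant H Q' f D -> (forall u, u \in Q' -> u \notin H) ->
    (2 * #|matched g :&: H| <= 3 * #|cover MA' :&: H|)%N.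
  move=> run EM inv QH; have fmat := inv_mating inv.
  apply: leq_trans (invariant_bound inv QH gmat) _.
  rewrite leq_mul2l /= subset_leq_card // setSI //.
  by rewrite -cover_mating_edges // -EM; exact: run_cover run f fmat EM.
elim=> {Q M MA} [M f D EM _ inv|u Q M p MA up pmax run IH f D EM|
                 u Q M MA ufail run IH f D EM].
- by apply: stop (Run_done _ _ _) EM inv _.
- rewrite pairwise_cons => /andP[uQ Qs] inv; have fmat := inv_mating inv.
  have [uH|uH] := boolP (u \in H); last first.
    apply: stop (Run_augment up pmax run) EM inv _ => v.
    rewrite !inE in uH *; case/predU1P => [->//|/(allP uQ)].
    rewrite -!ltNge in uH *.
    by move/le_lt_trans; apply.
  subst M.
  have [fu fp uneq [f' fs EM']] := short_augmentingP fmat up.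
  have [|D' inv'] := invariant_step inv uH fp uneq fs.
    move=> w wH fw uw uwl.
    have [q uq qw] := link_short_augmenting fmat fu fw uw uwl.
    by have := pmax q uq; rewrite qw !inE in wH *; apply: le_trans.
  apply: IH EM' _ inv'.
  exact: subseq_pairwise (rem_subseq _ _) Qs.
- rewrite pairwise_cons => /andP[uQ Qs] inv; have fmat := inv_mating inv.
  have fu := inv_queue inv (mem_head u Q).
  apply: (IH f D) => //; apply: invariant_skip inv _ => w fw uw uw_link.
  have [q uq _] := link_short_augmenting fmat fu fw uw uw_link.
  by have := ufail q; rewrite EM uq.
Qed.

End Run.

End Matings.

(** * Layer-cake summation and conclusion *)

(** Induction on the number of positive weights: subtract the least one, [t], from each of them; the
    removed layer is [t] times the indicator of [heavy phi t]. *)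
Lemma layer_cake (R : realFieldType) (V : finType) (phi : V -> R)
    (A B : {set V}) :
    (forall v, 0 <= phi v) ->
    (forall t, 0 < t -> (2 * #|A :&: heavy phi t| <=
                         3 * #|B :&: heavy phi t|)%N) ->
  2 * \sum_(v in A) phi v <= 3 * \sum_(v in B) phi v.
Proof.
have [n] := ubnP #|[set v | 0 < phi v]|.
elim: n phi => // n IH phi phin phi0 AB.
have [v0 v0P|phiN] := pickP (fun v => 0 < phi v); last first.
  have phi00 v : phi v = 0.
    by apply/eqP; rewrite eq_le phi0 leNgt phiN.
  by rewrite !big1 ?mulr0.
pose P := fun v => 0 < phi v.
have [m mP mmin] := arg_minP (P := P) phi v0P; set t := phi m in mmin.
pose psi v := if P v then phi v - t else 0.
have t0 : 0 < t by [].
have phiE v : phi v = psi v + (if t <= phi v then t else 0).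
  rewrite /psi; have [/mmin->|] := boolP (P v); first by rewrite subrK.
  rewrite /P -leNgt => vle0; rewrite ifF ?addr0; last first.
    by apply/negbTE; rewrite -ltNge; apply: le_lt_trans t0.
  by apply/eqP; rewrite eq_le vle0 phi0.
have psiAB : 2 * \sum_(v in A) psi v <= 3 * \sum_(v in B) psi v.
  apply: IH => [|v|s s0].
  - rewrite -ltnS; apply: leq_trans phin; rewrite ltnS; apply: proper_card.
    apply/properP; split; last first.
      by exists m; rewrite !inE // /psi ifT // subrr ltxx.
    apply/subsetP => v; rewrite !inE /psi; case: ifP => //.
    by rewrite ltxx.
  - by rewrite /psi; case: ifP => // /mmin; rewrite subr_ge0.
  - have -> : heavy psi s = heavy phi (s + t).
      apply/setP => v; rewrite !inE /psi.
      case: ifP => Pv; first by rewrite lerBrDr.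
      rewrite leNgt s0 /=; apply/esym/negbTE; rewrite -ltNge.
      apply: le_lt_trans (addr_gt0 s0 t0); rewrite leNgt; exact: negbT Pv.
    by apply: AB; apply: addr_gt0.
have sumE (C : {set V}) : \sum_(v in C) phi v =
    \sum_(v in C) psi v + t *+ #|C :&: heavy phi t|.
  rewrite (eq_bigr _ (fun v _ => phiE v)) big_split /=; congr (_ + _).
  by rewrite -big_mkcondr -sumr_const; apply: eq_bigl => v; rewrite !inE.
rewrite !sumE !mulrDr; apply: lerD psiAB _.
rewrite -![t *+ _]mulr_natl !mulrA -!natrM.
by apply: ler_wpM2r (ltW t0) _ _ _; rewrite ler_nat AB.
Qed.

Theorem theorem2 (R : realFieldType) (V : finType) (e : rel V)
    (e_sym : symmetric e) (e_irr : irreflexive e)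
    (phi : V -> R) (phi_ge0 : forall v : V, 0 <= phi v)
    (MA : {set {set V}}) (MA_output : two_thirds_output e phi MA)
    (M : {set {set V}}) (M_matching : is_matching e M) :
  matching_weight phi M <= 3 / 2 * matching_weight phi MA.
Proof.
have [g gmat ->] := matching_mating e_sym e_irr M_matching.
rewrite mulrAC ler_pdivlMr // mulrC /matching_weight.
rewrite (cover_mating_edges gmat).
have [Q [QV Qs run]] := MA_output.
apply: layer_cake => // t t0.
have m0 : matched (id : V -> V) = set0 by apply/setP => v; rewrite !inE eqxx.
apply: (run_bound e_sym e_irr gmat run (f := id) (D := set0)).
- by apply/setP => X; rewrite /mating_edges m0 imset0.
- by rewrite -sorted_pairwise // => a b c ab bc; apply: le_trans bc ab.
(* Initially the mating is the identity, all vertices are queued and none is dead. *)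
split=> //.
- by split=> // v; rewrite eqxx.
- by rewrite (perm_uniq QV) enum_uniq.
- by move=> u w _ _ _; rewrite (perm_mem QV) mem_enum.
- exact: sub0set.
- by move=> d z w; rewrite inE.
- by rewrite m0 cards0.
Qed.
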